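(* The class $[e^{\pi\mathrm i/3},1/2,4]$ is nonempty, and $4$ is the smallest local dimension in Lechner's exceptional family $[e^{\pi\mathrm i/3},1/2,2m]$ for which the class is nonempty.
   Context: A unitary Yang--Baxter operator on a finite-dimensional Hilbert space $D$ is a unitary $S\in\mathrm{End}(D\otimes D)$ with $(S\otimes I)(I\otimes S)(S\otimes I)=(I\otimes S)(S\otimes I)(I\otimes S)$. For such $S$ with $\mathrm{Spec}(S)=\{-1,q\}$, $q\ne\pm1$, put $p_S=\frac{qI-S}{1+q}$ and $\eta(S)=\mathrm{rank}(p_S)/(\dim D)^2$ (the spectral density). Two such operators are equivalent in Lechner's sense if their associated representations of every braid group ($\sigma_i\mapsto I^{\otimes(i-1)}\otimes S\otimes I^{\otimes(n-i-1)}$ on $D^{\otimes n}$) are unitarily equivalent. $[q,\eta,d]$ denotes the (possibly empty) equivalence class of such operators with Hecke parameter $q$, spectral density $\eta$ and local dimension $d=\dim D$. Lechner's exceptional family, from his classification of unitary R-matrices with two eigenvalues, is the family of classes $[e^{\pi\mathrm i/3},1/2,2m]$ indexed by integers $m\ge2$. *)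

(* Defs.v *)
From mathcomp Require Import all_boot all_order all_algebra.
From mathcomp Require Import spectral.
From mathcomp Require Import complex mxtens.
From mathcomp Require Import boolp classical_sets reals trigo.

Set Implicit Arguments.
Unset Strict Implicit.
Unset Printing Implicit Defensive.

Import Order.TTheory GRing.Theory Num.Theory.

Local Open Scope classical_set_scope.
Local Open Scope ring_scope.

(* A Hilbert space D of dimension d is taken with an orthonormal basis, so     *)
(* that D = C^d with C = R[i], End(D) = 'M_d, D (x) D = C^(d * d), the tensor  *)
(* product of operators is the Kronecker product *t, and unitarity is          *)
(* membership in unitarymx.                                                    *)

Lemma tensor_power_dim (d a b n : nat) :
  (a + 2 + b = n)%N -> (d ^ a * (d * d) * d ^ b = d ^ n)%N.
Proof. by move=> <-; rewrite mulnn -!expnD. Qed.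

(* The cast identifies D (x) (D (x) D) with (D (x) D) (x) D; it preserves the  *)
(* value of the indices, and hence is the usual associator.                    *)
Definition yang_baxter_eq (R : realType) (d : nat) (S : 'M[R[i]]_(d * d)) : Prop :=
  let S12 : 'M[R[i]]_(d * d * d) := S *t (1%:M : 'M_d) in
  let S23 : 'M[R[i]]_(d * d * d) :=
    castmx (mulnA d d d, mulnA d d d) ((1%:M : 'M_d) *t S) in
  S12 *m S23 *m S12 = S23 *m S12 *m S23.

Definition unitary_yang_baxter (R : realType) (d : nat)
    (S : 'M[R[i]]_(d * d)) : Prop :=
  S \is unitarymx /\ yang_baxter_eq S.

Definition spectrum (R : realType) (n : nat) (A : 'M[R[i]]_n) : set R[i] :=
  [set a | eigenvalue A a].

Definition hecke_projection (R : realType) (d : nat) (q : R[i])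
    (S : 'M[R[i]]_(d * d)) : 'M[R[i]]_(d * d) :=
  (1 + q)^-1 *: (q%:M - S).

Definition spectral_density (R : realType) (d : nat) (q : R[i])
    (S : 'M[R[i]]_(d * d)) : R :=
  (\rank (hecke_projection q S))%:R / (d ^ 2)%:R.

Definition hecke_yang_baxter (R : realType) (q : R[i]) (eta : R) (d : nat)
    (S : 'M[R[i]]_(d * d)) : Prop :=
  [/\ unitary_yang_baxter S, spectrum S = [set -1; q],
      q <> 1 /\ q <> -1 & spectral_density q S = eta].

(* I^(x)a (x) S (x) I^(x)b on D^(x)n, where n = a + 2 + b: this is the image   *)
(* of the generator sigma_(a + 1) of the braid group on n strands.             *)
Definition braid_generator (R : realType) (d : nat) (S : 'M[R[i]]_(d * d))
    (a b n : nat) (h : (a + 2 + b = n)%N) : 'M[R[i]]_(d ^ n) :=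
  castmx (tensor_power_dim d h, tensor_power_dim d h)
    ((1%:M : 'M_(d ^ a)) *t S *t (1%:M : 'M_(d ^ b))).

(* Representations of the braid group are unitarily equivalent as soon as a    *)
(* unitary intertwines the images of the generators. Both operators have the   *)
(* same local dimension, as the case n = 1 forces it anyway.                   *)
Definition lechner_equiv (R : realType) (d : nat)
    (S S' : 'M[R[i]]_(d * d)) : Prop :=
  forall n : nat, exists2 U : 'M[R[i]]_(d ^ n), U \is unitarymx &
    forall (a b : nat) (h : (a + 2 + b = n)%N),
      U *m braid_generator S h = braid_generator S' h *m U.

(* The class [q, eta, d], as the set of its members: the unitary Yang-Baxter   *)
(* operators equivalent to one with the parameters q, eta, d.                  *)
Definition hecke_class (R : realType) (q : R[i]) (eta : R) (d : nat) :
    set 'M[R[i]]_(d * d) :=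
  [set S | unitary_yang_baxter S /\
    exists2 S0, hecke_yang_baxter q eta S0 & lechner_equiv S0 S].

Arguments hecke_class {R} q eta d _.

Definition expi (R : realType) (t : R) : R[i] := (cos t +i* sin t)%C.

Definition exceptional_class (R : realType) (d : nat) : set 'M[R[i]]_(d * d) :=
  hecke_class (expi (pi / 3)) (1 / 2) d.

Arguments exceptional_class R d _ : clear implicits.

Definition nonempty_exceptional_dims (R : realType) : set nat :=
  [set d | exists2 m : nat, (2 <= m)%N & d = (2 * m)%N /\
    exceptional_class R d !=set0].

(* Main.v *)
Require Import Defs.
From mathcomp Require Import all_boot all_order all_algebra.
From mathcomp Require Import ring lra.
From mathcomp Require Import spectral.
From mathcomp Require Import complex mxtens.
From mathcomp Require Import boolp classical_sets reals trigo.

(* The lower bound is built into the indexing m >= 2, so only an operator in   *)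
(* dimension 4 is needed. It comes from the quaternionic representation of the *)
(* Hecke algebra at q = exp(i pi/3), due to Goldschmidt and Jones: if u, v     *)
(* generate a copy of the quaternions then h = 1 + u + v + uv satisfies        *)
(* (h - 1)^2 = -3, so that S = (q - 1)/2 h has the eigenvalues -1 and q. Two   *)
(* such pairs with [u1, u2] = [v1, v2] = 1 and u1, v2 (resp. v1, u2)           *)
(* anticommuting satisfy h1 h2 h1 = h2 h1 h2. On D = C^2 (x) C^2 take          *)
(* u = i A (x) B and v = i X (x) Y, where A, B, X, Y are Pauli operators whose *)
(* commutation signs yield these relations between neighbouring sites. The two *)
(* eigenspaces of S have the same dimension since u - v anticommutes with      *)
(* u + v + uv.                                                                 *)

Set Implicit Arguments.
Unset Strict Implicit.
Unset Printing Implicit Defensive.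

Import Order.TTheory GRing.Theory Num.Theory.

Local Open Scope classical_set_scope.
Local Open Scope ring_scope.
Local Open Scope sesquilinear_scope.

(** With h = 1 + x and x^2 = -3, the braid relation amounts to x1 + x1 x2 x1 = x2 + x2 x1 x2, which
    [hurwitz_braid] settles by sign rules. [hecke_yang_baxter_imaginary] obtains unitarity, spectrum
    and density from x and an operator anticommuting with it. [exceptional_class_pauli] reduces the
    rest to a table of commutation signs, which [exceptional_class_4] realizes on two qubits. *)

Definition quaternion_pair (T : pzRingType) (u v : T) :=
  [/\ u * u = -1, v * v = -1 & v * u = - (u * v)].

(** Twice the Hurwitz unit (1 + i + j + k)/2; without the half it makes sense in every ring. *)
Definition hurwitz (T : pzRingType) (u v : T) : T := 1 + u + v + u * v.

(** * Quaternion pairs and their braid relation *)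

Section Quaternions.
Variables (K : comNzRingType) (n : nat).
Implicit Types u v : 'M[K]_n.

Lemma quaternion_pair_mul u v : quaternion_pair u v ->
  [/\ u * (u * v) = - v, u * v * u = v, v * (u * v) = u,
      u * v * v = - u & u * v * (u * v) = -1].
Proof.
move=> [uu vv vu]; have vuv : v * (u * v) = u.
  by rewrite mulrA vu mulNr -mulrA vv mulrN1 opprK.
split=> //; first by rewrite mulrA uu mulN1r.
- by rewrite -mulrA vu mulrN mulrA uu mulN1r opprK.
- by rewrite -mulrA vv mulrN1.
- by rewrite -mulrA vuv uu.
Qed.

Lemma quaternion_pair_imaginary_sqr u v : quaternion_pair u v ->
  (u + v + u * v) * (u + v + u * v) = - 3%:M.
Proof.
move=> uvP; have [uw wu vw wv ww] := quaternion_pair_mul uvP.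
case: uvP => uu vv vu.
rewrite !(mulrDl, mulrDr) uu vv vu uw wu vw wv ww -idmxE.
move: (u * v) => w.
by apply/matrixP => i j; rewrite !mxE; case: (i == j) => /=; ring.
Qed.

(** With w = uv, each of u2, v2, w2 commutes with its namesake among u1, v1, w1 and anticommutes
    with the other two. Hence x1 u2 x1 = u2 (u1 - v1 - w1) (u1 + v1 + w1) = u2 + 2 (v1 - w1) u2, and
    likewise for v2 and w2. *)
Lemma quaternion_pair_sandwich u1 v1 u2 v2 :
  quaternion_pair u1 v1 -> quaternion_pair u2 v2 ->
  u2 * u1 = u1 * u2 -> v2 * v1 = v1 * v2 ->
  u2 * v1 = - (v1 * u2) -> v2 * u1 = - (u1 * v2) ->
  (u1 + v1 + u1 * v1) * (u2 + v2 + u2 * v2) * (u1 + v1 + u1 * v1) =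
  u2 + v2 + u2 * v2 + ((v1 - u1 * v1) * u2 + (u1 * v1 - u1) * v2 +
    (u1 - v1) * (u2 * v2)) *+ 2.
Proof.
move=> [u1u1 v1v1 v1u1] [u2u2 v2v2 v2u2] u2u1 v2v1 u2v1 v2u1.
have extend (a b c : 'M[K]_n) : a * b = c -> forall x, x * a * b = x * c.
  by move=> <- x; rewrite mulrA.
(* These rules bring every word to the form +- u1^a v1^b u2^c v2^d with        *)
(* exponents 0 or 1.                                                           *)
pose rules := (u1u1, v1v1, v1u1, u2u1, v2v1, u2v1, v2u1,
  extend _ _ _ u1u1, extend _ _ _ v1v1, extend _ _ _ v1u1,
  extend _ _ _ u2u1, extend _ _ _ v2v1, extend _ _ _ u2v1, extend _ _ _ v2u1,
  mulNr, mulrN, opprK, mul1r, mulr1, mulrA).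
rewrite !(mulrDl, mulrBl, mulrDr, mulrA) !rules.
move: (u1 * v1 * u2 * v2) (u1 * v1 * u2) (u1 * v1 * v2) (u1 * u2 * v2)
  (v1 * u2 * v2) (u1 * v1) (u2 * v2) (u1 * u2) (u1 * v2) (v1 * u2) (v1 * v2).
move=> *.
by apply/matrixP => i j; rewrite !mxE; ring.
Qed.

(** By [quaternion_pair_sandwich], x1 x2 x1 - x2 is a combination of products of differently named
    units. These anticommute, so the combination is unchanged when the two pairs are exchanged. *)
Lemma hurwitz_braid u1 v1 u2 v2 :
  quaternion_pair u1 v1 -> quaternion_pair u2 v2 ->
  u2 * u1 = u1 * u2 -> v2 * v1 = v1 * v2 ->
  u2 * v1 = - (v1 * u2) -> v2 * u1 = - (u1 * v2) ->
  hurwitz u1 v1 * hurwitz u2 v2 * hurwitz u1 v1 =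
  hurwitz u2 v2 * hurwitz u1 v1 * hurwitz u2 v2.
Proof.
move=> uv1 uv2 u2u1 v2v1 u2v1 v2u1.
have u1v2 : u1 * v2 = - (v2 * u1) by rewrite v2u1 opprK.
have v1u2 : v1 * u2 = - (u2 * v1) by rewrite u2v1 opprK.
have E12 := quaternion_pair_sandwich uv1 uv2 u2u1 v2v1 u2v1 v2u1.
have E21 := quaternion_pair_sandwich uv2 uv1 (esym u2u1) (esym v2v1) u1v2 v1u2.
have sq1 := quaternion_pair_imaginary_sqr uv1.
have sq2 := quaternion_pair_imaginary_sqr uv2.
have hE (u v : 'M[K]_n) : hurwitz u v = 1 + (u + v + u * v) by rewrite /hurwitz !addrA.
have w1u2 : u1 * v1 * u2 = - (u2 * (u1 * v1)).
  by rewrite -mulrA v1u2 mulrN !mulrA u2u1.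
have w1v2 : u1 * v1 * v2 = - (v2 * (u1 * v1)).
  by rewrite -mulrA -v2v1 !mulrA u1v2 mulNr.
have u1w2 : u1 * (u2 * v2) = - (u2 * v2 * u1).
  by rewrite mulrA -u2u1 -!mulrA u1v2 mulrN.
have v1w2 : v1 * (u2 * v2) = - (u2 * v2 * v1).
  by rewrite mulrA v1u2 mulNr -!mulrA v2v1.
rewrite (mulrBl u2) (mulrBl v2) (mulrBl (u2 * v2)) v1u2 w1u2 w1v2 u1v2 u1w2 v1w2 in E12.
rewrite (mulrBl u1) (mulrBl v1) (mulrBl (u1 * v1)) in E21.
rewrite !hE; move: (u1 + v1 + u1 * v1) (u2 + v2 + u2 * v2) sq1 sq2 E12 E21.
move=> x1 x2 sq1 sq2 E12 E21.
rewrite !(mulrDl, mulrDr, mulr1, mul1r) sq1 sq2 E12 E21.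
move: (x1 * x2) (x2 * x1) (u2 * u1) (u2 * v1) (u2 * (u1 * v1)) (v2 * u1) (v2 * v1)
  (v2 * (u1 * v1)) (u2 * v2 * u1) (u2 * v2 * v1) (u2 * v2 * (u1 * v1)).
move=> a b c d e f g h k l m.
by apply/matrixP => i j; rewrite !mxE; ring.
Qed.

(** Orthogonal imaginary quaternions anticommute, and u - v is orthogonal to u + v + uv. *)
Lemma quaternion_pair_reflection u v : quaternion_pair u v ->
  (u + v + u * v) * (u - v) = - ((u - v) * (u + v + u * v)).
Proof.
move=> uvP; have [uw wu vw wv ww] := quaternion_pair_mul uvP.
case: uvP => uu vv vu.
rewrite !(mulrBl, mulrBr, mulrDl, mulrDr) uu vv vu uw wu vw wv.
move: (u * v) => w.
by apply/matrixP => i j; rewrite !mxE; ring.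
Qed.

Lemma quaternion_pair_sub_sqr u v : quaternion_pair u v ->
  (u - v) * (u - v) = - 2%:M.
Proof.
move=> [uu vv vu].
rewrite !(mulrBl, mulrBr) uu vv vu -idmxE.
move: (u * v) => w.
by apply/matrixP => i j; rewrite !mxE; case: (i == j) => /=; ring.
Qed.
End Quaternions.

(** * Algebra of Kronecker products *)

Section Tensors.
Variables (K : comNzRingType).

Lemma tensmxDl m n p q (A B : 'M[K]_(m, n)) (M : 'M[K]_(p, q)) :
  (A + B) *t M = A *t M + B *t M.
Proof. by apply/matrixP=> i j; rewrite !mxE mulrDl. Qed.

Lemma tensmxDr m n p q (M : 'M[K]_(m, n)) (A B : 'M[K]_(p, q)) :
  M *t (A + B) = M *t A + M *t B.
Proof. by apply/matrixP=> i j; rewrite !mxE mulrDr. Qed.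

Lemma tensmxZl m n p q a (A : 'M[K]_(m, n)) (B : 'M[K]_(p, q)) :
  (a *: A) *t B = a *: (A *t B).
Proof. by apply/matrixP=> i j; rewrite !mxE mulrA. Qed.

Lemma tensmxZr m n p q a (A : 'M[K]_(m, n)) (B : 'M[K]_(p, q)) :
  A *t (a *: B) = a *: (A *t B).
Proof. by apply/matrixP=> i j; rewrite !mxE mulrCA. Qed.

Lemma tensmxNl m n p q (A : 'M[K]_(m, n)) (B : 'M[K]_(p, q)) :
  (- A) *t B = - (A *t B).
Proof. by apply/matrixP=> i j; rewrite !mxE mulNr. Qed.

Lemma tensmxNr m n p q (A : 'M[K]_(m, n)) (B : 'M[K]_(p, q)) :
  A *t (- B) = - (A *t B).
Proof. by apply/matrixP=> i j; rewrite !mxE mulrN. Qed.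

Lemma tensmx11 m n : (1%:M : 'M[K]_m) *t (1%:M : 'M[K]_n) = 1%:M.
Proof.
apply/matrixP=> i j; case: (mxtens_indexP i)=> i0 i1.
case: (mxtens_indexP j)=> j0 j1; rewrite tensmxE !mxE -natrM mulnb.
congr (nat_of_bool _)%:R; rewrite -xpair_eqE.
by apply/eqP/eqP => [->|/(can_inj (@mxtens_indexK _ _))].
Qed.

(** Both bracketings number the triples of indices lexicographically, so the cast changes no index
    value. *)
Lemma tensmxA m n p q r s (A : 'M[K]_(m, n)) (B : 'M[K]_(p, q))
    (M : 'M[K]_(r, s)) :
  castmx (mulnA m p r, mulnA n q s) (A *t (B *t M)) = A *t B *t M.
Proof.
apply/matrixP=> i j; case: (mxtens_indexP i)=> i01 i2.
case: (mxtens_indexP i01)=> i0 i1.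
case: (mxtens_indexP j)=> j01 j2; case: (mxtens_indexP j01)=> j0 j1.
rewrite castmxE.
have -> : cast_ord (esym (mulnA m p r)) (mxtens_index (mxtens_index (i0, i1), i2))
  = mxtens_index (i0, mxtens_index (i1, i2)).
  by apply: val_inj => /=; rewrite mulnDl -mulnA addnA.
have -> : cast_ord (esym (mulnA n q s)) (mxtens_index (mxtens_index (j0, j1), j2))
  = mxtens_index (j0, mxtens_index (j1, j2)).
  by apply: val_inj => /=; rewrite mulnDl -mulnA addnA.
by rewrite !tensmxE mulrA.
Qed.
End Tensors.

(** * Ranks of complementary projections *)

Lemma mxrank_complement (F : fieldType) n (P : 'M[F]_n) :
  P *m (1%:M - P) = 0 -> (\rank P + \rank ((1%:M - P)%R : 'M[F]_n) = n)%N.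
Proof.
move=> P0; apply/anti_leq; rewrite mulmx0_rank_max //=.
by have := mxrank_add P (1%:M - P); rewrite addrC subrK mxrank1.
Qed.

(** Conjugation by t carries P to 1 - P, so the two ranks agree; they add up to n. *)
Lemma mxrank_conj_complement (F : fieldType) n (P t : 'M[F]_n) :
  P *m P = P -> t \in unitmx -> P *m t = t *m (1%:M - P) ->
  (\rank P * 2 = n)%N.
Proof.
move=> PP tU Pt.
have PP0 : P *m (1%:M - P) = 0 by rewrite mulmxBr mulmx1 PP subrr.
apply: etrans (mxrank_complement PP0).
rewrite muln2 -addnn; congr addn.
rewrite -(mxrankMfree P (B := t)) ?row_free_unit// Pt.
by rewrite eqmxMfull ?row_full_unit.
Qed.

(** * The Hecke parameter, spectrum and density *)

Section Hecke.
Variable (R : realType).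
Local Notation C := R[i].

(** The triple angle formula gives 4 c^3 - 3 c + 1 = (c + 1) (2 c - 1)^2 = 0, and c > 0 excludes the
    first factor. *)
Lemma cos_pi3 : cos (pi / 3) = 1 / 2 :> R.
Proof.
set t := pi / 3.
have c0 : 0 < cos t.
  by apply: cos_gt0_pihalf; have := pi_gt0 R; rewrite /t => ?; apply/andP; split; lra.
have : cos (t *+ 2 + t) = -1.
  by rewrite -mulrSr -cospi; congr cos; rewrite /t -mulr_natr; field.
rewrite cosD cos_mulr2n sin_mulr2n.
have := sin2cos2 t; set c := cos t in c0 *; set s := sin t => s2 c3.
have : (c + 1) * (2 * c - 1) ^+ 2 = 0.
  have -> : (c + 1) * (2 * c - 1) ^+ 2 =
    ((c ^+ 2 *+ 2 - 1) * c - (c * s) *+ 2 * s) + 1 + 2 * c * (s ^+ 2 - (1 - c ^+ 2)) by ring.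
  by rewrite c3 s2; ring.
move/eqP; rewrite mulf_eq0 expf_eq0 /= => /orP[/eqP|/eqP] ?; lra.
Qed.

(** A primitive sixth root of unity is a root of X^2 - X + 1. *)
Lemma expi_pi3_sqr : expi (pi / 3) * expi (pi / 3) = expi (pi / 3) - 1 :> C.
Proof.
have s2 := sin2cos2 (pi / 3 : R); rewrite cos_pi3 in s2.
apply/eqP; rewrite eq_complex /= cos_pi3.
by apply/andP; split; apply/eqP; [rewrite -[sin _ * sin _]expr2 s2|]; field.
Qed.

Lemma expi_pi3_conj : (expi (pi / 3) : C)^* = 1 - expi (pi / 3).
Proof.
apply/eqP; rewrite eq_complex /= cos_pi3.
by apply/andP; split; apply/eqP; field.
Qed.

Lemma idempotent_spectrum n (a b : C) (P : 'M[C]_n) :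
  P *m P = P -> P != 0 -> 1%:M - P != 0 -> a != b ->
  spectrum (b%:M + (a - b) *: P) = [set a; b].
Proof.
move=> PP P0 P1 ab; apply/seteqP; split => [c /eigenvalueP[v vS v0]|c].
  (* An eigenvector v for c gives (a - b) vP = (c - b) v; a further factor P forces (c - a) vP =
     0. *)
  have vP : (a - b) *: (v *m P) = (c - b) *: v.
    by rewrite [RHS]scalerBl -vS mulmxDr mul_mx_scalar -scalemxAr [RHS]addrC addKr.
  have : ((c - b) * (c - a)) *: v = 0.
    have := congr1 (fun w => w *m P) vP.
    rewrite -!scalemxAl -mulmxA PP => vPP.
    have h : (c - a) *: (v *m P) = 0.
      have -> : c - a = (c - b) - (a - b) by ring.
      by rewrite scalerBl vPP subrr.
    by rewrite mulrC -scalerA -vP scalerA mulrC -scalerA h scaler0.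
  move/eqP; rewrite scaler_eq0 (negPf v0) orbF mulf_eq0 !subr_eq0 => /orP[]/eqP ->.
  - by right.
  - by left.
have eig (Q : 'M[C]_n) e : Q != 0 -> Q *m (b%:M + (a - b) *: P) = e *: Q ->
    eigenvalue (b%:M + (a - b) *: P) e.
  move=> /rowV0Pn[v /submxP[w ->] v0] QS; apply/eigenvalueP; exists (w *m Q) => //.
  by rewrite -mulmxA QS scalemxAr.
case=> ->.
- apply: (eig P) => //; rewrite mulmxDr mul_mx_scalar -scalemxAr PP -scalerDl.
  by rewrite addrC subrK.
- apply: (eig (1%:M - P)) => //; rewrite mulmxDr mul_mx_scalar -scalemxAr.
  by rewrite mulmxBl mul1mx PP subrr scaler0 addr0.
Qed.

(** As x^2 = -3, the factor (q - 1)/2 sends the eigenvalues of 1 + x to -1 and q. Unitarity comes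
    from |q - 1| = 1 and (1 + x) (1 - x) = 4. The density is 1/2 because the invertible t
    anticommutes with x and so exchanges the two eigenspaces. *)
Lemma hecke_yang_baxter_imaginary d (q : C) (S x t : 'M[C]_(d * d)) :
  S = ((q - 1) / 2) *: (1%:M + x) ->
  q * q = q - 1 -> q^* = 1 - q -> (0 < d)%N -> x *m x = - 3%:M -> x^t* = - x ->
  t *m t = - 2%:M -> x *m t = - (t *m x) ->
  yang_baxter_eq S -> hecke_yang_baxter q (1 / 2) S.
Proof.
move=> defS qq qJ d0 xx xH tt xt SYB.
have q1 : q + 1 != 0.
  (* At q = -1 the polynomial q^2 - q + 1 would take the value 3. *)
  apply/eqP => q1; have : (q + 1) * (q - 2) = - 3.
    have -> : (q + 1) * (q - 2) = q * q - q - 2 by ring.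
    by rewrite qq; ring.
  by rewrite q1 mul0r => /eqP; rewrite eq_sym oppr_eq0 pnatr_eq0.
have q0 : q != 0.
  apply/eqP => q0; move: qq; rewrite q0 mul0r sub0r => /eqP.
  by rewrite eq_sym oppr_eq0 oner_eq0.
(* Since r^2 = -1/3, the operator r x is an involution and P = (1 - r x)/2 is idempotent. *)
set r := (q - 1) / (q + 1).
have rr : r * r = - (1 / 3).
  rewrite /r mulrACA -invfM.
  have -> : (q - 1) * (q - 1) = - q.
    have -> : (q - 1) * (q - 1) = q * q - 2 * q + 1 by ring.
    by rewrite qq; ring.
  have -> : (q + 1) * (q + 1) = 3 * q.
    have -> : (q + 1) * (q + 1) = q * q + 2 * q + 1 by ring.
    by rewrite qq; ring.
  by field.
set P := hecke_projection q S.
have PE : P = (1 / 2) *: (1%:M - r *: x).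
  rewrite /P /hecke_projection defS /r; apply/matrixP => i j; rewrite !mxE.
  by rewrite [1 + q]addrC; case: (i == j) => /=; field; rewrite q1.
have PP : P *m P = P.
  rewrite PE -scalemxAl -scalemxAr mulmxBl !mulmxBr !mulmx1 !mul1mx.
  rewrite -scalemxAl -scalemxAr !scalerA rr xx.
  by apply/matrixP => i j; rewrite !mxE; case: (i == j) => /=; field.
have SE : S = q%:M + (-1 - q) *: P.
  rewrite /P /hecke_projection scalerA.
  have -> : (-1 - q) * (1 + q)^-1 = -1 by field; rewrite addrC.
  by rewrite scaleN1r opprB addrC subrK.
have tU : t \in unitmx.
  suff : t *m (- (1 / 2) *: t) = 1%:M by case/mulmx1_unit.
  rewrite -scalemxAr tt.
  by apply/matrixP => i j; rewrite !mxE; case: (i == j) => /=; field.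
have rkP : (\rank P * 2 = d * d)%N.
  apply: (mxrank_conj_complement PP tU); rewrite PE.
  rewrite -scalemxAl mulmxBl mulmxBr mulmx1 mul1mx -scalemxAl xt -scalemxAr.
  rewrite mulmxBr mulmx1 -scalemxAr.
  move: (t *m x) => y.
  by apply/matrixP => i j; rewrite !mxE; field.
split => //.
- split=> //; apply/unitarymxP.
  have -> : S ^t* = ((q - 1) / 2)^* *: (1%:M - x).
    rewrite defS linearZ /= map_mxZ linearD /= map_mxD trmx1 map_mx1.
    by rewrite xH.
  rewrite defS -scalemxAl -scalemxAr mulmxDl !mulmxBr !mulmx1 mul1mx xx scalerA.
  have -> : (q - 1) / 2 * ((q - 1) / 2)^* = 1 / 4.
    rewrite rmorphM rmorphB fmorphV /= rmorph1 qJ rmorph_nat.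
    have -> : (q - 1) / 2 * ((1 - q - 1) / 2) = (q - q * q) / 4 by field.
    by rewrite qq; field.
  by apply/matrixP => i j; rewrite !mxE; case: (i == j) => /=; field.
(* Half rank excludes both P = 0 and P = 1, so both eigenvalues occur. *)
- rewrite SE; apply: idempotent_spectrum => //.
  + by rewrite -mxrank_eq0 -lt0n -(ltn_pmul2r (ltn0Sn 1)) rkP mul0n muln_gt0 d0.
  + apply/eqP => P1; have P1' : P = 1%:M by rewrite -(subKr 1%:M P) P1 subr0.
    move: rkP; rewrite P1' mxrank1 => /eqP.
    by rewrite -{2}[(d * d)%N]muln1 eqn_pmul2l ?muln_gt0 ?d0.
  + by rewrite -subr_eq0 -opprD oppr_eq0 addrC.
- split.
  + move=> q1E; move: qq; rewrite q1E mulr1 subrr => /eqP.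
    by rewrite oner_eq0.
  + by move=> qN; move: q1; rewrite qN addNr eqxx.
- rewrite /spectral_density -/P.
  have -> : (d ^ 2)%:R = (\rank P)%:R * 2 :> R by rewrite -natrM rkP mulnn.
  have : (\rank P)%:R != 0 :> R.
    by rewrite pnatr_eq0 -lt0n -(ltn_pmul2r (ltn0Sn 1)) rkP mul0n muln_gt0 d0.
  by move=> rk0; field.
Qed.

(** * Membership in the class from commutation signs *)

Lemma lechner_equiv_refl d (S : 'M[C]_(d * d)) : lechner_equiv S S.
Proof.
move=> n; exists 1%:M => [|a b h]; last by rewrite mul1mx mulmx1.
by apply/unitarymxP; rewrite trmx1 map_mx1 mulmx1.
Qed.

(** With [tensmx_hurwitzl] and [tensmx_hurwitzr], this turns S12 and S23 into the same multiple of
    Hurwitz elements on three sites, where [hurwitz_braid] applies. *)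
Lemma castmx_hurwitz m m' (e : m = m') a (u v : 'M[C]_m) :
  castmx (e, e) (a *: hurwitz u v) =
  a *: hurwitz (castmx (e, e) u) (castmx (e, e) v).
Proof. by case: m' / e; rewrite !castmx_id. Qed.

Lemma castmxZ m n m' n' (e : (m = m') * (n = n')) a (A : 'M[C]_(m, n)) :
  castmx e (a *: A) = a *: castmx e A.
Proof. by case: e => e1 e2; case: m' / e1; case: n' / e2; rewrite !castmx_id. Qed.

Lemma tensmx_hurwitzl m n a (u v : 'M[C]_m) :
  (a *: hurwitz u v) *t (1%:M : 'M_n) =
  a *: hurwitz (u *t (1%:M : 'M_n)) (v *t (1%:M : 'M_n)).
Proof.
rewrite tensmxZl /hurwitz -!mulmxE !tensmxDl tensmx_mul mulmx1.
by rewrite -!idmxE tensmx11.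
Qed.

Lemma tensmx_hurwitzr m n a (u v : 'M[C]_n) :
  (1%:M : 'M_m) *t (a *: hurwitz u v) =
  a *: hurwitz ((1%:M : 'M_m) *t u) ((1%:M : 'M_m) *t v).
Proof.
rewrite tensmxZr /hurwitz -!mulmxE !tensmxDr tensmx_mul mulmx1.
by rewrite -!idmxE tensmx11.
Qed.

Lemma adjmxZ m n (a : C) (A : 'M[C]_(m, n)) : (a *: A)^t* = a^* *: A^t*.
Proof. by rewrite linearZ /= map_mxZ. Qed.

Lemma adjmx_mul m n p (A : 'M[C]_(m, n)) (B : 'M[C]_(n, p)) :
  (A *m B)^t* = B^t* *m A^t*.
Proof. by rewrite trmx_mul map_mxM. Qed.

Lemma adjmx_tens m n p r (A : 'M[C]_(m, n)) (B : 'M[C]_(p, r)) :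
  (A *t B)^t* = A^t* *t B^t*.
Proof. by rewrite trmx_tens map_mxT. Qed.

Lemma scalemx_braid n a (A B : 'M[C]_n) :
  A *m B *m A = B *m A *m B ->
  (a *: A) *m (a *: B) *m (a *: A) = (a *: B) *m (a *: A) *m (a *: B).
Proof. by move=> AB; rewrite -!(scalemxAl, scalemxAr) AB. Qed.

Lemma imaginary_sqr : 'i * 'i = -1 :> C.
Proof. by rewrite -expr2 sqrCi. Qed.

Lemma mulmx_iZ m n p (A : 'M[C]_(m, n)) (B : 'M[C]_(n, p)) :
  ('i *: A) *m ('i *: B) = - (A *m B).
Proof. by rewrite -scalemxAl -scalemxAr scalerA imaginary_sqr scaleN1r. Qed.

Definition hermitian_involution d (A : 'M[C]_d) := A *m A = 1%:M /\ A^t* = A.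

(** Neighbouring operators overlap in one site, where the second factor of one meets the first
    factor of the other: the pairs (B, A), (Y, X), (Y, A), (B, X) decide the four mixed relations.
    The pairs (X, A) and (Y, B) make u and v anticommute, and the factor i turns involutions into
    square roots of -1. *)
Lemma exceptional_class_pauli d (A B X Y : 'M[C]_d) :
  (0 < d)%N ->
  hermitian_involution A -> hermitian_involution B ->
  hermitian_involution X -> hermitian_involution Y ->
  X *m A = - (A *m X) -> Y *m A = - (A *m Y) -> X *m B = - (B *m X) ->
  B *m A = A *m B -> Y *m X = X *m Y -> Y *m B = B *m Y ->
  exceptional_class R d !=set0.
Proof.
move=> d0 [AA AH] [BB BH] [XX XH] [YY YH] XA YA XB BA YX YB.
pose u := 'i *: (A *t B); pose v := 'i *: (X *t Y).
have uvP : quaternion_pair u v.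
  split; rewrite -mulmxE mulmx_iZ tensmx_mul ?AA ?BB ?XX ?YY ?tensmx11 //.
  by rewrite mulmx_iZ tensmx_mul XA YB tensmxNl.
pose q : C := expi (pi / 3).
pose S := ((q - 1) / 2) *: hurwitz u v.
have SYB : yang_baxter_eq S.
  rewrite /yang_baxter_eq /= /S tensmx_hurwitzl tensmx_hurwitzr castmx_hurwitz.
  rewrite /u /v 2!tensmxZl 2!tensmxZr 2!castmxZ 2!tensmxA.
  apply: scalemx_braid; rewrite !mulmxE; apply: hurwitz_braid.
  - split; rewrite -mulmxE mulmx_iZ !tensmx_mul ?AA ?BB ?XX ?YY ?mulmx1 ?tensmx11 //.
    by rewrite mulmx_iZ !tensmx_mul XA YB mulmx1 !tensmxNl.
  - split; rewrite -mulmxE mulmx_iZ !tensmx_mul ?AA ?BB ?XX ?YY ?mulmx1 ?tensmx11 //.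
    by rewrite mulmx_iZ !tensmx_mul XA YB mulmx1 tensmxNr tensmxNl.
  - by rewrite -mulmxE !mulmx_iZ !tensmx_mul !mulmx1 !mul1mx BA.
  - by rewrite -mulmxE !mulmx_iZ !tensmx_mul !mulmx1 !mul1mx YX.
  - by rewrite -mulmxE !mulmx_iZ !tensmx_mul !mulmx1 !mul1mx YA tensmxNr tensmxNl !opprK.
  - by rewrite -mulmxE !mulmx_iZ !tensmx_mul !mulmx1 !mul1mx XB tensmxNr tensmxNl !opprK.
have SE : S = ((q - 1) / 2) *: (1%:M + (u + v + u *m v)).
  by rewrite /S /hurwitz !addrA.
have uH : u^t* = - u by rewrite adjmxZ adjmx_tens AH BH conjCi scaleNr.
have vH : v^t* = - v by rewrite adjmxZ adjmx_tens XH YH conjCi scaleNr.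
suff HS : hecke_yang_baxter q (1 / 2) S.
  by exists S; split; [case: HS | exists S => //; exact: lechner_equiv_refl].
apply: (hecke_yang_baxter_imaginary SE expi_pi3_sqr expi_pi3_conj d0 _ _ _ _ SYB).
- exact: (quaternion_pair_imaginary_sqr uvP).
(* The adjoint of uv is vu = -uv, so all three summands are anti-Hermitian. *)
- rewrite !linearD /= !map_mxD adjmx_mul uH vH mulNmx mulmxN opprK.
  by case: uvP => _ _; rewrite -mulmxE => ->.
- exact: (quaternion_pair_sub_sqr uvP).
- exact: (quaternion_pair_reflection uvP).
Qed.

(** * Pauli matrices on two qubits *)

Definition pauli_x : 'M[C]_2 := \matrix_(i, j) (i != j)%:R.
Definition pauli_z : 'M[C]_2 := \matrix_(i, j) ((-1) ^+ i *+ (i == j)).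

Ltac mx2 := apply/matrixP => -[[|[|//]] ?] -[[|[|//]] ?];
  rewrite !mxE ?big_ord_recl ?big_ord0 /= ?mxE /=.

Lemma pauli_x_hermitian : hermitian_involution pauli_x.
Proof.
split; first by mx2; ring.
by apply/matrixP => i j; rewrite !mxE rmorph_nat eq_sym.
Qed.

Lemma pauli_z_hermitian : hermitian_involution pauli_z.
Proof.
split; first by mx2; ring.
apply/matrixP => i j; rewrite !mxE rmorphMn rmorph_sign eq_sym.
by case: eqVneq => // ->.
Qed.

Lemma pauli_zx : pauli_z *m pauli_x = - (pauli_x *m pauli_z).
Proof. by mx2; rewrite ?big_ord_recl ?big_ord0 /= ?mxE /=; ring. Qed.

Lemma hermitian_involution_tens m n (A : 'M[C]_m) (B : 'M[C]_n) :
  hermitian_involution A -> hermitian_involution B ->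
  hermitian_involution (A *t B).
Proof.
move=> [AA AH] [BB BH]; split; first by rewrite tensmx_mul AA BB tensmx11.
by rewrite adjmx_tens AH BH.
Qed.

Lemma hermitian_involution1 n : hermitian_involution (1%:M : 'M[C]_n).
Proof. by split; rewrite ?mulmx1 // trmx1 map_mx1. Qed.

(** On C^2 the anticommuting A and Y would generate all matrices, making B scalar, yet B must
    anticommute with X. Two qubits suffice, with A = x (x) 1, B = 1 (x) x, X = z (x) z, Y = z (x)
    1. *)
Lemma exceptional_class_4 : exceptional_class R (2 * 2) !=set0.
Proof.
have X := pauli_x_hermitian; have Z := pauli_z_hermitian.
have one := hermitian_involution1 2; have zx := pauli_zx.
have T := hermitian_involution_tens.
apply: (exceptional_class_pauli _ (T _ _ _ _ X one) (T _ _ _ _ one X)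
  (T _ _ _ _ Z Z) (T _ _ _ _ Z one)) => //; rewrite !tensmx_mul ?mulmx1 ?mul1mx //.
- by rewrite zx tensmxNl.
- by rewrite zx tensmxNl.
- by rewrite zx tensmxNr.
Qed.
End Hecke.

Theorem corollary13p4 (R : realType) :
  exceptional_class R 4 !=set0 /\
  (nonempty_exceptional_dims R 4 /\
   forall d : nat, nonempty_exceptional_dims R d -> (4 <= d)%N).
Proof.
split; first exact: exceptional_class_4.
split; first by exists 2%N => //; split=> //; exact: exceptional_class_4.
by move=> d [m m2 [-> _]]; rewrite (leq_mul2l 2 2).
Qed.
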